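(* Let $\Psi(f)=-\int_{\mathbb R^d}f(x)\ln f(x)\,dx$ be the differential entropy. There exists $c>0$ such that for any $\vec\beta\in(0,\infty)^d$, $\vec L\in(0,\infty)^d$, $\vec r\in[1,\infty]^d$, $$\liminf_{n\to\infty}\ [\ln n]^3\ \inf_{\widetilde F}\ \sup_{f\in\mathcal F_\Psi\cap\mathbb N_{\vec r,d}(\vec\beta,\vec L)}\Big(\mathbb E_f\big[(\widetilde F-\Psi(f))^2\big]\Big)^{1/2}\ \ge\ c .$$
   Context: One observes i.i.d. vectors $X_1,\dots,X_n\in\mathbb R^d$ with common probability density $f$; $X^{(n)}=(X_1,\dots,X_n)$ and $\mathbb E_f$ is expectation under $f$. The infimum is over all estimators, i.e. real-valued measurable functions $\widetilde F$ of $X^{(n)}$; the supremum is over probability densities $f$ in the indicated class. $\mathcal F_\Psi:=\{f:|\Psi(f)|<\infty\}$, with $0\ln0=0$. For $G:\mathbb R^d\to\mathbb R$, $u\in\mathbb R$ and the canonical basis $e_1,\dots,e_d$, put $\Delta_{u,j}G(x)=G(x+ue_j)-G(x)$ and, inductively, $\Delta^k_{u,j}G=\Delta_{u,j}\Delta^{k-1}_{u,j}G$. The anisotropic Nikolskii class $\mathbb N_{\vec r,d}(\vec\beta,\vec L)$ is the set of functions $G:\mathbb R^d\to\mathbb R$ such that for every $j=1,\dots,d$: $\|G\|_{r_j}\le L_j$, and there exists a natural number $k_j>\beta_j$ with $\|\Delta^{k_j}_{u,j}G\|_{r_j}\le L_j|u|^{\beta_j}$ for all $u\in\mathbb R$ ($\|\cdot\|_s$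 is the $\mathbb L_s(\mathbb R^d)$-norm).
   Formalization: The formal theorem assumes that the class of densities over which the supremum is taken is nonempty; if some r_j = 1 and L_j < 1 no probability density lies in the class, and the stated bound fails. *)

(* Defs.v *)
From HB Require Import structures.
From mathcomp Require Import all_boot all_order all_algebra.
From mathcomp Require Import all_classical all_reals all_analysis.

Set Implicit Arguments.
Unset Strict Implicit.
Unset Printing Implicit Defensive.

Import Order.TTheory GRing.Theory Num.Theory.

Local Open Scope classical_set_scope.
Local Open Scope ring_scope.

Section tuple_cons.
Context d (T : measurableType d) (n : nat).

Definition tuple_cons (p : T * n.-tuple T) : n.+1.-tuple T :=
  [the n.+1.-tuple T of p.1 :: p.2].

Lemma measurable_tuple_cons : measurable_fun setT tuple_cons.
Proof. exact: measurable_cons. Qed.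

Lemma measurable_thead_behead : measurable_fun setT
  (fun t : n.+1.-tuple T => (tnth t ord0, [tuple of behead t])).
Proof.
apply: measurable_fun_pair; first exact: measurable_tnth.
exact: measurable_behead.
Qed.

Lemma tuple_consK : cancel tuple_cons
  (fun t : n.+1.-tuple T => (tnth t ord0, [tuple of behead t])).
Proof. by case=> x t; congr pair; apply/val_inj. Qed.

Lemma tuple_cons_behead (t : n.+1.-tuple T) :
  tuple_cons (tnth t ord0, [tuple of behead t]) = t.
Proof. by rewrite [RHS]tuple_eta; apply/val_inj. Qed.

End tuple_cons.

Section cons_measure.
Local Open Scope ereal_scope.
Context d (T : measurableType d) (R : realType) (n : nat).
Variables (mu : {sigma_finite_measure set T -> \bar R}).
Variable nu : {sigma_finite_measure set (n.-tuple T) -> \bar R}.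

Definition cons_measure : set (n.+1.-tuple T) -> \bar R :=
  pushforward (mu \x nu) (@tuple_cons _ T n).

Let mpre A : measurable A -> measurable (@tuple_cons _ T n @^-1` A).
Proof. by move=> mA; rewrite -[X in measurable X]setTI; exact: measurable_tuple_cons. Qed.

Let cons_measure0 : cons_measure set0 = 0.
Proof. by rewrite /cons_measure /pushforward preimage_set0 measure0. Qed.

Let cons_measure_ge0 A : 0 <= cons_measure A.
Proof. by rewrite /cons_measure /pushforward; exact: measure_ge0. Qed.

Let cons_measure_sigma_additive : semi_sigma_additive cons_measure.
Proof.
move=> F mF tF mUF; rewrite /cons_measure /pushforward preimage_bigcup.
apply: measure_semi_sigma_additive.
- by move=> k; exact: mpre.
- apply/trivIsetP => /= i j _ _ ij; rewrite -preimage_setI.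
  by move/trivIsetP : tF => /(_ _ _ _ _ ij) ->//; rewrite preimage_set0.
- by rewrite -preimage_bigcup; exact: mpre.
Qed.

HB.instance Definition _ := isMeasure.Build _ _ _ cons_measure
  cons_measure0 cons_measure_ge0 cons_measure_sigma_additive.

Let cons_measure_sigma_finite : sigma_finite setT cons_measure.
Proof.
have /sigma_finiteP[F [TF ndF Foo]] := sigma_finiteT mu.
have /sigma_finiteP[G [TG ndG Goo]] := sigma_finiteT nu.
pose g := fun t : n.+1.-tuple T => (tnth t ord0, [tuple of behead t]).
exists (fun k => g @^-1` (F k `*` G k)).
  rewrite -preimage_bigcup (_ : \bigcup_k _ = setT) ?preimage_setT//.
  rewrite -setXTT TF TG predeqE => -[x y]; split.
    by move=> [k _ []/= ? ?]; split; exists k.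
  move=> [/= [k _ Fkx] [l _ Gly]]; exists (maxn k l) => //; split.
  - by move: x Fkx; exact/subsetPset/ndF/leq_maxl.
  - by move: y Gly; exact/subsetPset/ndG/leq_maxr.
move=> k; have [mFk Fkoo] := Foo k; have [mGk Gkoo] := Goo k; split.
  rewrite -[X in measurable X]setTI; apply: measurable_thead_behead => //.
  exact: measurableX.
rewrite /cons_measure /pushforward -comp_preimage (_ : g \o _ = id); last first.
  by apply/funext => p; exact: tuple_consK.
by rewrite preimage_id product_measure1E// lte_mul_pinfty// ge0_fin_numE.
Qed.

HB.instance Definition _ := Measure_isSigmaFinite.Build _ _ _ cons_measure
  cons_measure_sigma_finite.

End cons_measure.

Section power_measure.
Local Open Scope ereal_scope.
Context d (T : measurableType d) (R : realType).
Variable mu : {sigma_finite_measure set T -> \bar R}.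

Fixpoint power_measure n : {sigma_finite_measure set (n.-tuple T) -> \bar R} :=
  if n is n'.+1 then cons_measure mu (power_measure n') else dirac [tuple].

Lemma power_measure_box n (A : 'I_n -> set T) :
  (forall i, measurable (A i)) ->
  power_measure n [set t | forall i, A i (tnth t i)] = \prod_(i < n) mu (A i).
Proof.
elim: n A => [|n IH] A mA.
  by rewrite big_ord0 /= diracE mem_set//= => -[].
rewrite big_ord_recl -IH// -product_measure1E//; last first.
  rewrite (_ : [set _ | _] =
      \bigcap_(i in [set: 'I_n]) ((fun t : n.-tuple T => tnth t i) @^-1` A (lift ord0 i))).
    apply: fin_bigcap_measurable => // i _.
    by rewrite -[X in measurable X]setTI; exact: measurable_tnth.
  by apply/seteqP; split => t /= h i; [move=> _|]; exact: h.
rewrite /= /cons_measure /pushforward; congr (product_measure1 _ _ _).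
apply/seteqP; split => -[x t] /=.
  move=> h; split; first exact: (h ord0).
  by move=> i; have := h (lift ord0 i); rewrite tnthS.
move=> [Ax At] i; have [j ->|->//] := unliftP ord0 i.
by rewrite tnthS.
Qed.

End power_measure.

(* Points of R^d are d-tuples carrying the product of the Borel sigma-algebras. *)
Notation Rd R d := (d.-tuple (measurableTypeR R)).

Section lebesgue_Rd.
Context (R : realType) (d : nat).

(* By power_measure_box, the measure of a box is the product of the side
   lengths. *)
Definition lebesgue_Rd : {sigma_finite_measure set (Rd R d) -> \bar R} :=
  power_measure (@lebesgue_measure R) d.

End lebesgue_Rd.

Section nikolskii.
Context (R : realType) (d : nat).
Implicit Types (G : Rd R d -> R) (x : Rd R d) (u : R) (j : 'I_d).

Definition shift_coord u j x : Rd R d :=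
  [tuple if i == j then (tnth x i : R) + u else tnth x i | i < d].

Definition difference_coord u j G : Rd R d -> R :=
  fun x => G (shift_coord u j x) - G x.

Definition nikolskii (r : 'I_d -> \bar R) (beta L : 'I_d -> R) :
    set (Rd R d -> R) :=
  [set G : Rd R d -> R | measurable_fun setT G /\ forall j : 'I_d,
    (Lnorm (lebesgue_Rd R d) (r j) (EFin \o G) <= (L j)%:E)%E /\
    exists k : nat, beta j < k%:R /\ forall u : R,
      (Lnorm (lebesgue_Rd R d) (r j) (EFin \o iter k (difference_coord u j) G)
        <= (L j * `|u| `^ beta j)%:E)%E].

End nikolskii.

Section entropy.
Context (R : realType) (d : nat).
Implicit Type f : Rd R d -> R.

Definition prob_density : set (Rd R d -> R) :=
  [set f : Rd R d -> R | [/\ measurable_fun setT f, forall x, 0 <= f x &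
    (\int[lebesgue_Rd R d]_x (f x)%:E = 1)%E]].

(* ln 0 = 0, so f x * ln (f x) vanishes where f does.  An integral whose
   positive and negative parts are both infinite has the value -oo, so for
   measurable f the condition in finite_entropy amounts to integrability of
   f ln f. *)
Definition diff_entropy f : \bar R :=
  (- \int[lebesgue_Rd R d]_x (f x * ln (f x))%:E)%E.

Definition finite_entropy : set (Rd R d -> R) :=
  [set f : Rd R d -> R | prob_density f /\ (`|diff_entropy f| < +oo)%E].

End entropy.

Section minimax.
Local Open Scope ereal_scope.
Context (R : realType) (d n : nat).

(* The law of n independent vectors with density f has density
   x |-> f (x_1) * ... * f (x_n) on (R^d)^n. *)
Definition expectation_iid (f : Rd R d -> R) (H : n.-tuple (Rd R d) -> R) :
    \bar R :=
  \int[power_measure (lebesgue_Rd R d) n]_x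
    (H x * \prod_(i < n) f (tnth x i))%R%:E.

Definition estimator : set (n.-tuple (Rd R d) -> R) :=
  [set F : n.-tuple (Rd R d) -> R | measurable_fun setT F].

Definition root_risk (Psi : (Rd R d -> R) -> \bar R) (f : Rd R d -> R)
    (F : n.-tuple (Rd R d) -> R) : \bar R :=
  sqrte (expectation_iid f (fun x => (F x - fine (Psi f)) ^+ 2)%R).

Definition minimax_risk (Psi : (Rd R d -> R) -> \bar R)
    (C : set (Rd R d -> R)) : \bar R :=
  ereal_inf [set ereal_sup [set root_risk Psi f F | f in C] | F in estimator].

End minimax.

(* Main.v *)
(* The class puts no restriction on the tails of a density, so the minimax risk
   is in fact +oo for every n.  Let f be any member of the class.  Stretch f by
   a factor a >= 1 along the first coordinate and take the half-half mixture h
   of f and its stretched copy.  Stretching a density by a >= 1 decreases its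
   L_p norms and those of its differences, so by Minkowski's inequality h stays
   in the class, with the same orders k_j.  By convexity of x ln x the entropy
   of h exceeds that of f by at least (ln a) / 2.  On the other hand f <= 2 h,
   hence the n-fold product densities satisfy f^n <= 2^n h^n, and a single
   estimator with squared risk at most s^2 at both f and h forces
   (Psi h - Psi f)^2 <= (2 + 2 * 2^n) s^2, which fails for a large. *)
Require Import Defs.
From mathcomp Require Import all_boot all_order all_algebra.
From mathcomp Require Import all_classical all_reals all_analysis.
From mathcomp Require Import measurable_realfun ess_sup_inf ring lra.

Import Order.TTheory GRing.Theory Num.Theory.

Local Open Scope classical_set_scope.
Local Open Scope ring_scope.

(** * Lebesgue measure under dilation of one coordinate *)

(** Uniqueness of Lebesgue measure: its image under division by [a], multiplied by [a^-1], gives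
    each interval []x, y]] its length. *)
Lemma lebesgue_measure_dilation (R : realType) (a : R) (A : set (measurableTypeR R)) :
  0 < a -> measurable A ->
  lebesgue_measure ((fun x : measurableTypeR R => a^-1 * x : measurableTypeR R) @^-1` A)
  = (a%:E * lebesgue_measure A)%E.
Proof.
move=> a0 mA.
have mphi : measurable_fun setT
    (fun x : measurableTypeR R => a^-1 * x : measurableTypeR R).
  exact: measurable_funM.
(* The scalar carried by [NngNum] is [a^-1], read off from its positivity proof. *)
have -> : lebesgue_measure A =
    mscale (NngNum (ltW (etrans (invr_gt0 a) a0)))
      (pushforward lebesgue_measure
         (fun x : measurableTypeR R => a^-1 * x : measurableTypeR R)) A.
  move=> m.
  apply: lebesgue_measure_unique => // _ [[x y] _ <-] /=.
  rewrite /mscale/= /pushforward.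
  rewrite (_ : _ @^-1` _ = `]a * x, a * y]%classic); last first.
    by apply/seteqP; split => z /=; rewrite !in_itv/= ltr_pdivlMl// ler_pdivrMl.
  rewrite !lebesgue_measure_itv/= !lte_fin ltr_pM2l//.
  case: ifP => _; last by rewrite mule0.
  by rewrite -!EFinD -EFinM -mulrBr mulrA mulVf ?gt_eqF// mul1r.
by rewrite /mscale/= muleA -EFinM mulfV ?gt_eqF// mul1e.
Qed.

Section dilation.
Context (R : realType) (d : nat).
Variable a : R.
Hypothesis a_gt0 : 0 < a.

(** Composing a function with this contraction stretches its graph by [a] along the first axis.
    Dimension [d.+1] guarantees that this axis exists. *)
Definition contract_coord0 (x : Rd R d.+1) : Rd R d.+1 :=
  [tuple if i == ord0 then a^-1 * (tnth x i : R) else tnth x i | i < d.+1].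

Lemma measurable_contract_coord0 : measurable_fun setT contract_coord0.
Proof.
apply/measurable_fun_tnthP => i /=.
rewrite (_ : _ \o _ = fun x : Rd R d.+1 =>
    if i == ord0 then a^-1 * (tnth x i : R) else tnth x i); last first.
  by apply/funext => x /=; rewrite tnth_mktuple.
case: (i == ord0); last exact: measurable_tnth.
by apply: measurable_funM => //; exact: measurable_tnth.
Qed.

(** Through [tuple_cons] the contraction becomes [h], acting on the first factor of a product
    measure; uniqueness of product measures reduces the claim to rectangles, hence to dimension
    one. *)
Lemma lebesgue_Rd_contract_coord0 (A : set (Rd R d.+1)) : measurable A ->
  lebesgue_Rd R d.+1 (contract_coord0 @^-1` A) = (a%:E * lebesgue_Rd R d.+1 A)%E.
Proof.
move=> mA.
have lebesgueE B : lebesgue_Rd R d.+1 B =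
  (lebesgue_measure \x lebesgue_Rd R d)%E
    (@tuple_cons _ (measurableTypeR R) d @^-1` B) by [].
rewrite !{}lebesgueE; set nu := lebesgue_Rd R d.
pose h : measurableTypeR R * Rd R d -> measurableTypeR R * Rd R d :=
  fun p => (a^-1 * (p.1 : R) : measurableTypeR R, p.2).
have mh : measurable_fun setT h.
  apply: measurable_fun_pair => //.
  by apply: measurable_funM => //.
set B := @tuple_cons _ (measurableTypeR R) d @^-1` A.
have mB : measurable B.
  by have := @measurable_tuple_cons _ (measurableTypeR R) d measurableT;
    move=> /(_ _ mA); rewrite setTI.
have -> : @tuple_cons _ (measurableTypeR R) d @^-1` (contract_coord0 @^-1` A) =
    h @^-1` B.
  apply/seteqP; split => -[x t]; rewrite /B /=;
    rewrite (_ : contract_coord0 _ = tuple_cons (a^-1 * x : measurableTypeR R, t))//;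
    apply: eq_from_tnth => i; rewrite tnth_mktuple;
    by have [j ->|->] := unliftP ord0 i; rewrite ?eqxx// !tnthS.
have -> : (lebesgue_measure \x nu)%E B =
    mscale (NngNum (ltW (etrans (invr_gt0 a) a_gt0)))
      (pushforward (lebesgue_measure \x nu)%E h) B.
  move=> m.
  apply: product_measure_unique => // C D mC mD.
  transitivity ((a^-1)%R%:E * (@lebesgue_measure R \x nu)
    (((fun x : measurableTypeR R => (a^-1 * x)%R : measurableTypeR R) @^-1` C)
      `*` D))%E => //.
  rewrite product_measure1E//; last first.
    by rewrite -[X in measurable X]setTI; apply: measurable_funM.
  transitivity ((a^-1)%R%:E * ((a%:E * @lebesgue_measure R C) * nu D))%E.
    by congr (_ * (_ * _))%E; exact: lebesgue_measure_dilation.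
  rewrite !muleA -[(_ * a%:E)%E]EFinM.
  by rewrite mulVf ?gt_eqF// mul1e.
by rewrite /mscale/= muleA -EFinM mulfV ?gt_eqF// mul1e.
Qed.

(** Since the contraction is linear, finite differences of a stretched function are stretched finite
    differences, with step divided by [a] along the first axis only. *)
Lemma contract_coord0_shift (u : R) (j : 'I_d.+1) (x : Rd R d.+1) :
  contract_coord0 (shift_coord u j x) =
  shift_coord (if j == ord0 then a^-1 * u else u) j (contract_coord0 x).
Proof.
apply: eq_from_tnth => i; rewrite !tnth_mktuple.
case: (eqVneq i j) => [->|//].
by case: ifP => // _; rewrite mulrDr.
Qed.

End dilation.

(** * Integrals and norms under a map that multiplies measure by a constant *)

Section scaled_measure.
Local Open Scope ereal_scope.
Context d (T : measurableType d) (R : realType).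
Variables (mu : {measure set T -> \bar R}) (S : T -> T) (a : R).
Hypotheses (a_ge0 : (0 <= a)%R) (mS : measurable_fun setT S).
Hypothesis muS : forall A, measurable A -> mu (S @^-1` A) = a%:E * mu A.

Lemma ge0_integral_comp_scaled (f : T -> \bar R) :
  measurable_fun setT f -> (forall x, 0 <= f x) ->
  \int[mu]_x f (S x) = a%:E * \int[mu]_x f x.
Proof.
move=> mf f0.
have <- := @ge0_integral_mscale _ T R mu setT measurableT (NngNum a_ge0) f mf
  (fun x _ => f0 x).
transitivity (\int[pushforward mu S]_x f x).
  by rewrite ge0_integral_pushforward.
by apply: eq_measure_integral => A mA _; exact: muS.
Qed.

Lemma integrable_comp_scaled (f : T -> \bar R) :
  mu.-integrable setT f -> mu.-integrable setT (f \o S).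
Proof.
move=> /integrableP[mf foo]; apply/integrableP; split.
  exact: measurableT_comp.
rewrite (ge0_integral_comp_scaled (abse \o f)); last 2 first.
- exact: measurableT_comp.
- by move=> x; exact: abse_ge0.
by rewrite lte_mul_pinfty ?lee_fin.
Qed.

Lemma integral_comp_scaled (f : T -> \bar R) : mu.-integrable setT f ->
  \int[mu]_x f (S x) = a%:E * \int[mu]_x f x.
Proof.
move=> intf; have mf := measurable_int _ intf.
rewrite integralE [in RHS]integralE muleBr//; last first.
  exact: integrable_add_def.
congr (_ - _).
  have -> : (fun x => f (S x))^\+ = f^\+ \o S by exact: funepos_comp.
  exact: (ge0_integral_comp_scaled f^\+ (measurable_funepos mf)
    (fun x => funepos_ge0 f x)).
have -> : (fun x => f (S x))^\- = f^\- \o S by exact: funeneg_comp.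
exact: (ge0_integral_comp_scaled f^\- (measurable_funeneg mf)
  (fun x => funeneg_ge0 f x)).
Qed.

Lemma Lnorm_comp_scaled_le (p : \bar R) (f : T -> R) :
  (1 <= a)%R -> 1 <= p -> measurable_fun setT f ->
  Lnorm mu p (EFin \o (f \o S)) <= a%:E * Lnorm mu p (EFin \o f).
Proof.
move=> a1; rewrite unlock /Lnorm; case: p => [p||//] p1 mf.
  rewrite (ge0_integral_comp_scaled (fun x => `|(f x)%:E| `^ p)); last 2 first.
  - apply: (measurableT_comp (measurable_poweR p)).
    by apply: measurableT_comp => //; exact/measurable_EFinP.
  - by move=> x; exact: poweR_ge0.
  rewrite poweRM ?lee_fin//; last by apply: integral_ge0 => x _; exact: poweR_ge0.
  apply: lee_wpmul2r; first exact: poweR_ge0.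
  rewrite lee_fin in p1.
  rewrite poweR_EFin lee_fin -[leRHS]powRr1//.
  by rewrite ler_powR// invf_le1// (lt_le_trans _ p1).
(* The sup norm is 0 by convention when the whole space has measure 0. *)
case: ifPn => mu0; last by rewrite mule0.
set M := ess_sup mu (abse \o (EFin \o f)).
have M0 : 0 <= M by apply: ess_sup_gee => //; apply/nearW => x /=.
apply: (@le_trans _ _ M); last by rewrite -[leLHS]mul1e lee_wpmul2r.
apply/ess_supP.
have [N [mN N0 fN]] : \forall x \ae mu, (abse \o (EFin \o f)) x <= M.
  exact: ess_sup_ge.
exists (S @^-1` N); split.
- by rewrite -[X in measurable X]setTI; exact: mS.
- by rewrite muS// N0 mule0.
- by move=> x /= fSx; apply: fN.
Qed.

End scaled_measure.

(** * Homogeneity of norms and convexity of their balls *)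

Section Lnorm_lemmas.
Local Open Scope ereal_scope.
Context d (T : measurableType d) (R : realType).
Variable mu : {measure set T -> \bar R}.

Lemma LnormZ_ge0 (p : \bar R) (c : R) (f : T -> R) :
  (0 <= c)%R -> 1 <= p -> measurable_fun setT f ->
  Lnorm mu p (EFin \o (fun x => c * f x)%R) = c%:E * Lnorm mu p (EFin \o f).
Proof.
move=> c0; rewrite unlock /Lnorm; case: p => [p||//] p1 mf.
  rewrite lee_fin in p1.
  have p0 : (p != 0)%R by rewrite gt_eqF// (lt_le_trans _ p1).
  transitivity ((\int[mu]_x ((c `^ p)%:E * `|(EFin \o f) x| `^ p)) `^ p^-1).
    congr (_ `^ _); apply: eq_integral => x _.
    by rewrite /= normrM (ger0_norm c0) powRM// EFinM.
  rewrite ge0_integralZl_EFin//; last 3 first.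
  - by move=> x _; exact: poweR_ge0.
  - apply: (measurableT_comp (measurable_poweR p)).
    by apply: measurableT_comp => //; exact/measurable_EFinP.
  - exact: powR_ge0.
  rewrite poweRM ?lee_fin ?powR_ge0//; last first.
    by apply: integral_ge0 => x _; exact: poweR_ge0.
  by rewrite poweR_EFin -powRrM mulfV// powRr1.
case: ifPn => mu0; last by rewrite mule0.
rewrite -ess_supZl//; congr ess_sup; apply/funext => x /=.
by rewrite normrM EFinM ger0_norm.
Qed.

Lemma Lnorm_midpoint_le (p : \bar R) (M : \bar R) (f g : T -> R) :
  1 <= p -> measurable_fun setT f -> measurable_fun setT g ->
  Lnorm mu p (EFin \o f) <= M -> Lnorm mu p (EFin \o g) <= M ->
  Lnorm mu p (EFin \o (fun x => 2^-1 * f x + 2^-1 * g x)%R) <= M.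
Proof.
move=> p1 mf mg fM gM.
have h0 : (0 <= 2^-1 :> R)%R by [].
have mh (h : T -> R) : measurable_fun setT h ->
    measurable_fun setT (fun x : T => 2^-1 * h x)%R.
  by move=> mh; exact: measurable_funM.
have := eminkowski mu (mh _ mf) (mh _ mg) p1.
move=> /le_trans; apply; rewrite !LnormZ_ge0//.
apply: (@le_trans _ _ ((2^-1)%:E * M + (2^-1)%:E * M)).
  by apply: leeD; apply: lee_wpmul2l; rewrite ?lee_fin.
have M0 : 0 <= M by apply: le_trans fM; exact: Lnorm_ge0.
rewrite -ge0_muleDl ?lee_fin// -EFinD (_ : 2^-1 + 2^-1 = 1)%R ?mul1e//.
lra.
Qed.

End Lnorm_lemmas.

(** * Iterated finite differences *)

Section differences.
Context (R : realType) (d : nat).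
Implicit Types (G H : Rd R d -> R) (u : R) (j : 'I_d).

Lemma measurable_shift_coord u j :
  measurable_fun setT (shift_coord u j : Rd R d -> Rd R d).
Proof.
apply/measurable_fun_tnthP => i /=.
rewrite (_ : _ \o _ = fun x : Rd R d =>
    if i == j then (tnth x i : R) + u else tnth x i); last first.
  by apply/funext => x /=; rewrite tnth_mktuple.
case: (i == j); last exact: measurable_tnth.
by apply: measurable_funD => //; exact: measurable_tnth.
Qed.

Lemma measurable_iter_difference k u j G : measurable_fun setT G ->
  measurable_fun setT (iter k (difference_coord u j) G).
Proof.
move=> mG; elim: k => //= k IH.
apply: measurable_funB => //; apply: measurableT_comp => //.
exact: measurable_shift_coord.
Qed.

Lemma iter_difference_lincomb k u j (b c : R) G H :
  iter k (difference_coord u j) (fun x => b * G x + c * H x) =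
  (fun x => b * iter k (difference_coord u j) G x
          + c * iter k (difference_coord u j) H x).
Proof.
elim: k => //= k ->; apply/funext => x; rewrite /difference_coord; ring.
Qed.

End differences.

Lemma iter_difference_contract (R : realType) (d k : nat) (a u : R)
    (j : 'I_d.+1) (G : Rd R d.+1 -> R) :
  iter k (difference_coord u j) (G \o contract_coord0 R d a) =
  iter k (difference_coord (if j == ord0 then a^-1 * u else u) j) G
    \o contract_coord0 R d a.
Proof.
elim: k => //= k ->; apply/funext => x.
by rewrite /difference_coord /= contract_coord0_shift.
Qed.

(** * The mixture with a stretched copy stays in the Nikolskii class *)

Section half_spread.
Context (R : realType) (d : nat) (a : R).
Hypothesis a_ge1 : 1 <= a.
Let mu := lebesgue_Rd R d.+1.

(** The factor [a^-1] restores the mass of the stretched copy to one. *)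
Definition half_spread (f : Rd R d.+1 -> R) : Rd R d.+1 -> R :=
  fun x => 2^-1 * f x + 2^-1 * (a^-1 * f (contract_coord0 R d a x)).

Let a_gt0 : 0 < a. Proof. exact: lt_le_trans a_ge1. Qed.

(** The factor [a^-1] compensates the growth of the norm under stretching, and Minkowski handles the
    average. Two functions [f] and [g] are allowed because the differences of the two components may
    have different steps. *)
Lemma Lnorm_half_spread_le (p M : \bar R) (f g : Rd R d.+1 -> R) :
  (1 <= p)%E -> measurable_fun setT f -> measurable_fun setT g ->
  (Lnorm mu p (EFin \o f) <= M)%E ->
  (Lnorm mu p (EFin \o g) <= M)%E ->
  (Lnorm mu p (EFin \o (fun x => 2^-1 * f x +
      2^-1 * (a^-1 * g (contract_coord0 R d a x)))%R) <= M)%E.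
Proof.
move=> p1 mf mg fM gM; have mS := measurable_contract_coord0 R d a.
have mgS : measurable_fun setT (g \o contract_coord0 R d a).
  exact: measurableT_comp.
apply: Lnorm_midpoint_le => //; first exact: measurable_funM.
rewrite (LnormZ_ge0 _ _ _ _ _ _ (g \o contract_coord0 R d a)) ?invr_ge0 ?(ltW a_gt0)//.
apply: le_trans gM.
have := Lnorm_comp_scaled_le _ _ _ _ _ _ (ltW a_gt0) mS
  (lebesgue_Rd_contract_coord0 R d a a_gt0) p g a_ge1 p1 mg.
by rewrite -lee_pdivrMl.
Qed.

Lemma nikolskii_half_spread (r : 'I_d.+1 -> \bar R) (beta L : 'I_d.+1 -> R)
    (f : Rd R d.+1 -> R) :
  (forall j, 0 < beta j) -> (forall j, 0 < L j) -> (forall j, (1 <= r j)%E) ->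
  nikolskii r beta L f -> nikolskii r beta L (half_spread f).
Proof.
move=> beta0 L0 r1 [mf fN]; split.
  apply: measurable_funD; first exact: measurable_funM.
  apply: measurable_funM => //; apply: measurable_funM => //.
  by apply: measurableT_comp => //; exact: measurable_contract_coord0.
move=> j; have [fL [k [kb fk]]] := fN j; split.
  exact: Lnorm_half_spread_le.
exists k; split => // u.
have -> : iter k (difference_coord u j) (half_spread f) = fun x =>
    2^-1 * iter k (difference_coord u j) f x + 2^-1 * (a^-1 *
      iter k (difference_coord (if j == ord0 then a^-1 * u else u) j) f
        (contract_coord0 R d a x)).
  have := iter_difference_lincomb R d.+1 k u j 2^-1 (2^-1 * a^-1) f
    (f \o contract_coord0 R d a).
  rewrite iter_difference_contract /half_spread => h.
  under eq_fun do rewrite mulrA.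
  by rewrite h; under [RHS]eq_fun do rewrite mulrA.
apply: Lnorm_half_spread_le => //; try exact: measurable_iter_difference.
(* What remains is the bound for the stretched copy: its step, [u] or [a^-1 * u], is at most [u] in
   absolute value, and powers with exponent [beta j > 0] are monotone. *)
apply: le_trans (fk _) _; rewrite lee_fin ler_pM2l//.
case: ifP => // _; rewrite ge0_ler_powR ?nnegrE ?(ltW (beta0 j))//.
rewrite normrM ger0_norm ?invr_ge0 ?(ltW a_gt0)//.
by rewrite ler_piMl// invf_le1.
Qed.

End half_spread.

(** * Pointwise inequalities for x ln x *)

Section xlnx.
Context (R : realType).
Implicit Types (x y m a : R).

(** The left side is the tangent line of x ln x at [m]. The bound is ln t <= t - 1 at t = m / x. *)
Lemma xlnx_tangent_le x m : 0 <= x -> 0 < m -> x * ln m + x - m <= x * ln x.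
Proof.
rewrite le_eqVlt => /predU1P[<-|x0] m0; first by rewrite !mul0r !add0r oppr_le0 ltW.
have mx0 : 0 < m / x by rewrite divr_gt0.
have : ln (1 + (m / x - 1)) <= m / x - 1.
  by apply: le_ln1Dx; rewrite ltrBDl subrr.
rewrite addrC subrK ln_div ?posrE// -(ler_pM2l x0).
rewrite (mulrBr _ (m / x)) mulrCA mulfV ?gt_eqF//; lra.
Qed.

(** Averaging the two tangent inequalities at the midpoint [m] cancels the terms outside the
    logarithm. *)
Lemma xlnx_midpoint_le x y : 0 <= x -> 0 <= y ->
  (2^-1 * x + 2^-1 * y) * ln (2^-1 * x + 2^-1 * y) <=
  2^-1 * (x * ln x) + 2^-1 * (y * ln y).
Proof.
move=> x0 y0; set m := 2^-1 * x + 2^-1 * y.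
have : 0 <= m by rewrite /m; lra.
rewrite le_eqVlt => /predU1P[m0|m0].
  have -> : x = 0 by rewrite /m in m0; lra.
  have -> : y = 0 by rewrite /m in m0; lra.
  by rewrite -m0 !mul0r !mulr0 addr0.
have := xlnx_tangent_le x m x0 m0.
have := xlnx_tangent_le y m y0 m0.
have -> : m * ln m = 2^-1 * (x * ln m + y * ln m) by rewrite {1}/m; ring.
have : m = 2^-1 * x + 2^-1 * y by [].
lra.
Qed.

(** A converse to convexity up to a multiple of the midpoint, which later bounds h ln h from below
    by an integrable function. Monotonicity of ln gives x ln x + y ln y <= s ln s for s = x + y;
    halving s costs ln 2. *)
Lemma xlnx_midpoint_ge x y : 0 <= x -> 0 <= y ->
  2^-1 * (x * ln x) + 2^-1 * (y * ln y) - ln 2 * (2^-1 * x + 2^-1 * y) <=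
  (2^-1 * x + 2^-1 * y) * ln (2^-1 * x + 2^-1 * y).
Proof.
have lnD (u v : R) : 0 <= u -> 0 <= v -> u * ln u <= u * ln (u + v).
  rewrite le_eqVlt => /predU1P[<-|u0] v0; first by rewrite !mul0r.
  by rewrite ler_pM2l// ler_ln ?posrE ?ltr_wpDr// lerDl.
move=> x0 y0; have := lnD _ _ x0 y0; have := lnD _ _ y0 x0.
rewrite (addrC y x); set s := x + y.
have -> : 2^-1 * x + 2^-1 * y = s / 2 by rewrite /s; lra.
have : 0 <= s by rewrite /s addr_ge0.
rewrite le_eqVlt => /predU1P[s0|s0].
  have -> : x = 0 by rewrite /s in s0; lra.
  have -> : y = 0 by rewrite /s in s0; lra.
  by rewrite -s0 !(mul0r, mulr0, addr0, subr0).
rewrite ln_div ?posrE//.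
have -> : s / 2 * (ln s - ln 2) = 2^-1 * (x * ln s + y * ln s) - ln 2 * (s / 2).
  by rewrite /s; ring.
lra.
Qed.

Lemma xlnx_dilation a y : 0 < a -> 0 <= y ->
  (a^-1 * y) * ln (a^-1 * y) = a^-1 * (y * ln y) - (a^-1 * ln a) * y.
Proof.
move=> a0; rewrite le_eqVlt => /predU1P[<-|y0]; first by rewrite !(mulr0,mul0r) subr0.
rewrite lnM ?posrE ?invr_gt0// lnV ?posrE//; ring.
Qed.

End xlnx.

(** * Integrals of linear combinations *)

Section lincomb.
Local Open Scope ereal_scope.
Context d (T : measurableType d) (R : realType).
Variables (mu : {measure set T -> \bar R}) (g h : T -> R) (b c : R).
Hypotheses (ig : mu.-integrable setT (EFin \o g)).
Hypotheses (ih : mu.-integrable setT (EFin \o h)).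

Lemma integrable_lincomb :
  mu.-integrable setT (EFin \o (fun x => b * g x + c * h x)%R).
Proof.
have -> : EFin \o (fun x => b * g x + c * h x)%R =
    (fun x => b%:E * (EFin \o g) x) \+ (fun x => c%:E * (EFin \o h) x) by [].
by apply: integrableD => //; exact: integrableZl.
Qed.

Lemma integral_lincomb :
  \int[mu]_x (b * g x + c * h x)%:E =
  b%:E * \int[mu]_x (g x)%:E + c%:E * \int[mu]_x (h x)%:E.
Proof.
transitivity (\int[mu]_x (b%:E * (EFin \o g) x + c%:E * (EFin \o h) x)) => //.
by rewrite integralD// ?integralZl//; exact: integrableZl.
Qed.

End lincomb.

(** * Entropy of the mixture *)

Section half_spread_entropy.
Context (R : realType) (d : nat) (a : R).
Hypothesis a_ge1 : 1 <= a.
Let mu := lebesgue_Rd R d.+1.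
Let S := contract_coord0 R d a.
Let a_gt0 : 0 < a. Proof. exact: lt_le_trans a_ge1. Qed.
Let mS : measurable_fun setT S. Proof. exact: measurable_contract_coord0. Qed.
Let muS := lebesgue_Rd_contract_coord0 R d a a_gt0.

(** This domination of [f] by twice the mixture is what makes the two densities hard to tell apart
    from [n] observations. *)
Lemma half_spread_ge (f : Rd R d.+1 -> R) x :
  (forall x, 0 <= f x) -> 2^-1 * f x <= half_spread R d a f x.
Proof.
by move=> f0; rewrite lerDl mulr_ge0// mulr_ge0// invr_ge0 ltW.
Qed.

Lemma integrable_prob_density (f : Rd R d.+1 -> R) :
  prob_density f -> mu.-integrable setT (EFin \o f).
Proof.
move=> [mf f0 f1]; apply/integrableP; split; first exact/measurable_EFinP.
under eq_integral do rewrite gee0_abs ?lee_fin//.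
by rewrite /comp f1 ltry.
Qed.

Lemma integrable_xlnx (f : Rd R d.+1 -> R) : finite_entropy f ->
  mu.-integrable setT (EFin \o (fun x => f x * ln (f x))).
Proof.
move=> [[mf _ _] Hf].
have mflf : measurable_fun setT (fun x => f x * ln (f x)).
  apply: measurable_funM => //.
  by apply: measurableT_comp => //; exact: measurable_ln.
apply/integrableP; split; first exact/measurable_EFinP.
by rewrite integral_fin_num_abs// fin_num_abs -abseN.
Qed.

Lemma prob_density_half_spread (f : Rd R d.+1 -> R) :
  prob_density f -> prob_density (half_spread R d a f).
Proof.
move=> pf; have [mf f0 f1] := pf.
have fi := integrable_prob_density _ pf.
have fSi := integrable_comp_scaled _ _ _ _ _ _ (ltW a_gt0) mS muS _ fi.
split.
- apply: measurable_funD; first exact: measurable_funM.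
  apply: measurable_funM => //; apply: measurable_funM => //.
  exact: measurableT_comp.
- by move=> x; apply: le_trans (half_spread_ge f x f0); rewrite mulr_ge0.
- rewrite /half_spread.
  under eq_integral do rewrite mulrA.
  rewrite (integral_lincomb _ _ _ _ _ (f \o S))//.
  rewrite (integral_comp_scaled _ _ _ _ _ _ (ltW a_gt0) mS muS (EFin \o f))//.
  rewrite /comp f1 !mule1 -EFinM -EFinD; congr EFin.
  rewrite -mulrA mulVf ?gt_eqF//; lra.
Qed.

(** By convexity h ln h lies below [U], the average of the x ln x terms of the two components, whose
    integral is that of f ln f minus (ln a) / 2. It also lies above [U - ln 2 * h], hence is
    integrable. *)
Lemma entropy_half_spread (f : Rd R d.+1 -> R) : finite_entropy f ->
  finite_entropy (half_spread R d a f) /\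
  fine (diff_entropy f) + ln a / 2 <=
    fine (diff_entropy (half_spread R d a f)).
Proof.
move=> ff; have [pf _] := ff; have [mf f0 f1] := pf.
have fi := integrable_prob_density _ pf.
have ei := integrable_xlnx _ ff.
have fSi := integrable_comp_scaled _ _ _ _ _ _ (ltW a_gt0) mS muS _ fi.
have eSi := integrable_comp_scaled _ _ _ _ _ _ (ltW a_gt0) mS muS _ ei.
have ph := prob_density_half_spread _ pf.
have hi := integrable_prob_density _ ph.
have [mh h0 h1] := ph.
set e := fun x => f x * ln (f x).
(* [V] is the x ln x term of the stretched copy, expanded so that the change of variables applies to
   each summand. *)
set V := fun x => a^-1 * (e \o S) x + - (a^-1 * ln a) * (f \o S) x.
have Vi : mu.-integrable setT (EFin \o V) by exact: integrable_lincomb.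
set U := fun x => 2^-1 * e x + 2^-1 * V x.
have Ui : mu.-integrable setT (EFin \o U) by exact: integrable_lincomb.
have VE x : V x = (a^-1 * f (S x)) * ln (a^-1 * f (S x)).
  by rewrite xlnx_dilation// /V mulNr.
set h := half_spread R d a f.
have gS x : 0 <= a^-1 * f (S x) by rewrite mulr_ge0// invr_ge0 ltW.
have hU x : h x * ln (h x) <= U x.
  by rewrite /U VE; apply: xlnx_midpoint_le.
have Uh x : U x - ln 2 * h x <= h x * ln (h x).
  by rewrite /U VE; apply: xlnx_midpoint_ge.
have hhi : mu.-integrable setT (EFin \o (fun x => h x * ln (h x))).
  (* The dominating function is |U| + ln 2 * h; the coefficient 1 fits the form of
     [integrable_lincomb]. *)
  have Ui' : mu.-integrable setT (EFin \o (fun x => 1 * `|U x| + ln 2 * h x)).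
    by exact: integrable_lincomb (integrable_norm Ui) hi.
  have mhln : measurable_fun setT (fun x => h x * ln (h x)).
    apply: measurable_funM => //.
    by apply: measurableT_comp => //; exact: measurable_ln.
  apply: le_integrable Ui' => //; first exact/measurable_EFinP.
  move=> x _ /=; rewrite lee_fin mul1r.
  have l2 : 0 <= ln 2 * h x by rewrite mulr_ge0// ln_ge0// ler1n.
  rewrite (ger0_norm (addr_ge0 _ l2))// ler_norml; apply/andP; split.
    by apply: le_trans (Uh x); rewrite opprD lerD2r lerNnormlW.
  by apply: le_trans (hU x) _; rewrite (le_trans (ler_norm _))// lerDl.
have [E EE] : exists E : R, (\int[mu]_x (e x)%:E = E%:E)%E.
  by exists (fine (\int[mu]_x (e x)%:E)%E); rewrite fineK// integrable_fin_num.
have Hfin : (\int[mu]_x (h x * ln (h x))%:E)%E \is a fin_num.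
  exact: (integrable_fin_num _ hhi).
(* The integral of [V] is a^-1 (a E) - (a^-1 ln a) a = E - ln a, which is then averaged with [E]. *)
have UE : (\int[mu]_x (U x)%:E = (E - ln a / 2)%:E)%E.
  rewrite integral_lincomb//.
  rewrite integral_lincomb//.
  rewrite (integral_comp_scaled _ _ _ _ _ _ (ltW a_gt0) mS muS (EFin \o e))//.
  rewrite (integral_comp_scaled _ _ _ _ _ _ (ltW a_gt0) mS muS (EFin \o f))//.
  rewrite /comp f1 EE mule1.
  transitivity
    (2^-1 * E + 2^-1 * (a^-1 * (a * E) + - (a^-1 * ln a) * a))%:E => //.
  congr EFin.
  by field; rewrite gt_eqF.
split; first by split => //; rewrite /diff_entropy abseN -fin_num_abs.
have hE : fine (\int[mu]_x (h x * ln (h x))%:E)%E <= E - ln a / 2.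
  rewrite -lee_fin fineK// -UE.
  by apply: le_integral => // x _; rewrite lee_fin.
rewrite /diff_entropy !fineN EE /=; lra.
Qed.

End half_spread_entropy.

(** * Product densities *)

Section iid_density.
Local Open Scope ereal_scope.
Context d (T : measurableType d) (R : realType).
Variable mu : {sigma_finite_measure set T -> \bar R}.

Lemma measurable_iid_density (f : T -> R) n : measurable_fun setT f ->
  measurable_fun setT (fun t : n.-tuple T => \prod_(i < n) f (tnth t i))%R.
Proof.
move=> mf; apply: measurable_prod => i _.
by apply: measurableT_comp => //; exact: measurable_tnth.
Qed.

(** Induction on [n], splitting off the first observation by Tonelli. For [n = 0] the empty product
    is integrated against a Dirac mass. *)
Lemma integral_iid_density (f : T -> R) n :
  measurable_fun setT f -> (forall x, (0 <= f x)%R) ->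
  \int[mu]_x (f x)%:E = 1 ->
  \int[power_measure mu n]_t (\prod_(i < n) f (tnth t i))%:E = 1.
Proof.
move=> mf f0 f1; elim: n => [|n IH].
  under eq_integral do rewrite big_ord0.
  by rewrite integral_cst// mul1e /= diracT.
set nu := power_measure mu n in IH *.
transitivity (\int[pushforward (mu \x nu) (@tuple_cons _ T n)]_t
    (\prod_(i < n.+1) f (tnth t i))%:E).
  by apply: eq_measure_integral => [|A mA _]; first exact: measurable_tuple_cons.
have mp := measurable_iid_density f.
rewrite ge0_integral_pushforward//; last 3 first.
- exact: measurable_tuple_cons.
- by apply/measurable_EFinP; exact: mp.
- by move=> t _; rewrite lee_fin; exact: prodr_ge0.
rewrite preimage_setT fubini_tonelli1//; last 2 first.
- apply: (measurableT_comp
    (f := fun t : n.+1.-tuple T => (\prod_(i < n.+1) f (tnth t i))%:E)).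
    by apply/measurable_EFinP; exact: mp.
  exact: measurable_tuple_cons.
- by move=> t; rewrite lee_fin; exact: prodr_ge0.
rewrite -[RHS]f1; apply: eq_integral => x _; rewrite /fubini_F.
transitivity (\int[nu]_t ((f x)%:E * (\prod_(i < n) f (tnth t i))%:E)).
  apply: eq_integral => t _; rewrite /= big_ord_recl EFinM.
  by congr (_ * _%:E); apply: eq_bigr => i _; rewrite tnthS.
rewrite ge0_integralZl_EFin ?IH ?mule1//.
- by move=> t _; rewrite lee_fin; exact: prodr_ge0.
- by apply/measurable_EFinP; exact: mp.
Qed.

End iid_density.

(** * The two-point inequality *)

Section two_point.
Context (R : realType) (d n : nat).
Implicit Types (f g : Rd R d -> R) (F : n.-tuple (Rd R d) -> R).

Lemma measurable_risk_integrand f F (psi : R) :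
  measurable_fun setT f -> measurable_fun setT F ->
  measurable_fun setT (fun t : n.-tuple (Rd R d) =>
    (F t - psi) ^+ 2 * \prod_(i < n) f (tnth t i)).
Proof.
move=> mf mF; apply: measurable_funM; last exact: measurable_iid_density.
by apply: measurable_funX; exact: measurable_funB.
Qed.

(** The inequality (psi0 - psi1)^2 <= 2 (F - psi0)^2 + 2 (F - psi1)^2 is integrated against the
    product density of [f], which has mass one; in the last term that density is replaced by its
    bound, [2 ^+ n] times the product density of [g]. *)
Lemma two_point_risk f g F (psi0 psi1 : R) :
  prob_density f -> prob_density g -> (forall x, 2^-1 * f x <= g x) ->
  measurable_fun setT F ->
  (((psi0 - psi1) ^+ 2)%:E <=
   2%:E * expectation_iid f (fun t => (F t - psi0) ^+ 2)%R +
   (2 * 2 ^+ n)%:E * expectation_iid g (fun t => (F t - psi1) ^+ 2)%R)%E.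
Proof.
move=> [mf f0 f1] [mg g0 _] fg mF.
have If := integral_iid_density _ _ _ (lebesgue_Rd R d) f n mf f0 f1.
rewrite -[leLHS]mule1 -If /expectation_iid.
have m0 := measurable_risk_integrand f F psi0 mf mF.
have m1 := measurable_risk_integrand g F psi1 mg mF.
have P0 (h : Rd R d -> R) (t : n.-tuple (Rd R d)) : (forall x, 0 <= h x) ->
    0 <= \prod_(i < n) h (tnth t i) by move=> h0; exact: prodr_ge0.
have Z (k : R) (h : n.-tuple (Rd R d) -> R) : 0 <= k -> measurable_fun setT h ->
    (forall t, 0 <= h t) ->
    (k%:E * \int[power_measure (lebesgue_Rd R d) n]_t (h t)%:E =
     \int[power_measure (lebesgue_Rd R d) n]_t (k * h t)%:E)%E.
  move=> k0 mh h0; rewrite -ge0_integralZl_EFin//; last exact/measurable_EFinP.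
  by move=> t _; rewrite lee_fin.
have r0 (psi : R) h t : (forall x, 0 <= h x) ->
    0 <= (F t - psi) ^+ 2 * \prod_(i < n) h (tnth t i).
  by move=> h0; rewrite mulr_ge0 ?sqr_ge0 ?P0.
have mp := measurable_iid_density _ _ _ f n mf.
rewrite !Z ?sqr_ge0 ?mulr_ge0 ?exprn_ge0//; last 3 first.
- by move=> t; exact: r0.
- by move=> t; exact: r0.
- by move=> t; exact: P0.
rewrite -ge0_integralD//; last 4 first.
- by move=> t _; rewrite lee_fin mulr_ge0// r0.
- by apply/measurable_EFinP; exact: measurable_funM.
- by move=> t _; rewrite lee_fin; apply: mulr_ge0;
    [rewrite mulr_ge0 ?exprn_ge0|exact: r0].
- by apply/measurable_EFinP; exact: measurable_funM.
apply: ge0_le_integral => //.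
- by move=> t _; rewrite lee_fin mulr_ge0 ?sqr_ge0 ?P0.
- by apply/measurable_EFinP; exact: measurable_funM.
- by apply/measurable_EFinP/measurable_funD; exact: measurable_funM.
move=> t _; rewrite -EFinD lee_fin.
have : \prod_(i < n) f (tnth t i) <= 2 ^+ n * \prod_(i < n) g (tnth t i).
  rewrite -[X in 2 ^+ X]card_ord -prodr_const -big_split /=.
  by apply: ler_prod => i _; rewrite f0 /=; have := fg (tnth t i); lra.
have := P0 f t f0; have := P0 g t g0.
move: (\prod_(i < n) f _) (\prod_(i < n) g _) => p q q0 p0 pq.
apply: (@le_trans _ _ (2 * ((F t - psi0) ^+ 2 * p) + 2 * (F t - psi1) ^+ 2 * p)).
  rewrite mulrA -mulrDl ler_wpM2r//.
  (* With A and B the two errors, 2 A^2 + 2 B^2 - (A - B)^2 = (A + B)^2. *)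
  have := sqr_ge0 ((F t - psi0) + (F t - psi1)); lra.
rewrite lerD2l (_ : _ * (_ * q) = 2 * (F t - psi1) ^+ 2 * (2 ^+ n * q)).
  by rewrite ler_wpM2l// mulr_ge0 ?sqr_ge0.
by move: (2 ^+ n) => K; ring.
Qed.

End two_point.

(** * Infinite minimax risk and the conclusion *)

Lemma minimax_risk_infinite (R : realType) (d n : nat) (r : 'I_d.+1 -> \bar R)
    (beta L : 'I_d.+1 -> R) :
  (forall j, 0 < beta j) -> (forall j, 0 < L j) -> (forall j, (1 <= r j)%E) ->
  (@finite_entropy R d.+1 `&` nikolskii r beta L) !=set0 ->
  minimax_risk n (@diff_entropy R d.+1)
    (@finite_entropy R d.+1 `&` nikolskii r beta L) = +oo%E.
Proof.
move=> beta0 L0 r1 [f [ff fN]]; apply/eqP; rewrite -leye_eq.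
apply: le_ereal_inf_tmp => _ [F mF <-].
set C := _ `&` _; set s := ereal_sup _.
have risk_le g : C g -> (root_risk (@diff_entropy R d.+1) g F <= s)%E.
  by move=> Cg; apply: ereal_sup_ubound; exists g.
have expect_ge0 g (psi : R) : prob_density g ->
    (0 <= expectation_iid g (fun t => (F t - psi) ^+ 2)%R)%E.
  move=> [_ g0 _]; apply: integral_ge0 => t _.
  by rewrite lee_fin mulr_ge0 ?sqr_ge0// prodr_ge0.
have : (0 <= s)%E by apply: le_trans (risk_le f (conj ff fN)); exact: sqrte_ge0.
case: s risk_le => [s||//] risk_le s0; last by rewrite lexx.
(* From here the worst-case root risk of [F] is a real number [s], to be contradicted. *)
rewrite lee_fin in s0; exfalso.
have expect_le g : C g ->
    (expectation_iid g (fun t => (F t - fine (diff_entropy g)) ^+ 2)%R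
     <= (s ^+ 2)%:E)%E.
  move=> Cg; rewrite -lee_sqrt ?lee_fin ?sqr_ge0//= sqrtr_sqr ger0_norm//.
  exact: risk_le.
(* [B] is the bound that [two_point_risk] puts on the squared entropy gap; [a] is chosen so that (ln
   a) / 2 = B + 1. *)
pose B := (2 + 2 * 2 ^+ n) * s ^+ 2.
have B0 : 0 <= B by rewrite mulr_ge0 ?sqr_ge0// addr_ge0// mulr_ge0// exprn_ge0.
pose a := expR (2 * (B + 1)).
have a1 : 1 <= a by rewrite -expR0 ler_expR mulr_ge0// addr_ge0.
have a0 : 0 < a by exact: expR_gt0.
have [hf hE] := entropy_half_spread R d a a1 f ff.
have hN := nikolskii_half_spread R d a a1 r beta L f beta0 L0 r1 fN.
have [[pf _] [ph _]] := (ff, hf); have [_ f0 _] := pf.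
have := two_point_risk R d.+1 n f _ F (fine (diff_entropy f)) (fine (diff_entropy
  (half_spread R d a f))) pf ph (fun x => half_spread_ge R d a a1 f x f0) mF.
apply/negP; rewrite -ltNge.
apply: (@le_lt_trans _ _ B%:E).
  have -> : B%:E = (2%:E * (s ^+ 2)%:E + (2 * 2 ^+ n)%:E * (s ^+ 2)%:E)%E.
    by rewrite /B mulrDl.
  apply: leeD.
    by rewrite lee_pmul2l//; exact: expect_le.
  by rewrite lee_pmul2l ?lte_fin ?mulr_gt0 ?exprn_gt0//; exact: expect_le.
rewrite lte_fin; rewrite expRK in hE.
(* The gap is at least B + 1, and (B + 1)^2 > B since B >= 0. *)
move: (fine _) (fine _) hE => p0 p1 hE; nra.
Qed.

(** The class can be empty, for instance when some [r j = 1] and [L j < 1]; the supremum over it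
    would then be -oo, hence the nonemptiness assumption. *)
Theorem theorem5 (R : realType) (d : nat) (d_gt0 : (0 < d)%N) :
  exists c : R, 0 < c /\
    forall (beta L : 'I_d -> R) (r : 'I_d -> \bar R),
      (forall j : 'I_d, 0 < beta j) ->
      (forall j : 'I_d, 0 < L j) ->
      (forall j : 'I_d, (1 <= r j)%E) ->
      (@finite_entropy R d `&` nikolskii r beta L) !=set0 ->
      (c%:E <= limn_einf (fun n : nat =>
         (ln (n%:R : R) ^+ 3)%:E *
         minimax_risk n (@diff_entropy R d)
           (@finite_entropy R d `&` nikolskii r beta L)))%E.
Proof.
case: d d_gt0 => // d _; exists 1; split => // beta L r beta0 L0 r1 C0.
suff /cvg_limn_einf_sup[-> _] : (fun n : nat => (ln (n%:R : R) ^+ 3)%:E *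
    minimax_risk n (@diff_entropy R d.+1)
      (@finite_entropy R d.+1 `&` nikolskii r beta L))%E @ \oo --> +oo%E.
  exact: leey.
(* For n >= 2 the factor ln n is positive, so the product is +oo; for smaller n it is 0 * +oo =
   0. *)
apply: cvg_near_cst; exists 2%N => // n /= n2.
rewrite minimax_risk_infinite// gt0_muley// lte_fin exprn_gt0// ln_gt0//.
by rewrite ltr1n.
Qed.
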